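(* Let $\mathcal S=(\gamma_1,\gamma_2)$ be a pair of weighted density operators on a finite-dimensional complex Hilbert space $\mathscr H$ and let $E_?$ be an operator on $\mathscr H$. There exist operators $E_1$ and $E_2$ such that $\mathcal E=(E_1,E_2,E_?)$ is a proper USD measurement of $\mathcal S$ if and only if $E_?$ acts as the identity on $\ker\mathcal S$, $E_?\ge0$, $1-E_?\ge0$, and $\gamma_1(1-E_?)\gamma_2=0$. Moreover, given $E_?$, the proper USD measurement $\mathcal E$ of $\mathcal S$ is unique.
   Context: A weighted density operator is a positive semi-definite operator on $\mathscr H$ (no normalization of the trace is required). For a positive semi-definite operator $\rho$, $\operatorname{supp}\rho=(\ker\rho)^\perp$. For $\mathcal S=(\gamma_1,\gamma_2)$ put $\operatorname{supp}\mathcal S=\operatorname{supp}(\gamma_1+\gamma_2)=\operatorname{supp}\gamma_1+\operatorname{supp}\gamma_2$ and $\ker\mathcal S=\ker(\gamma_1+\gamma_2)=\ker\gamma_1\cap\ker\gamma_2$. A USD (unambiguous state discrimination) measurement of $\mathcal S$ is a triple $\mathcal E=(E_1,E_2,E_?)$ of positive semi-definite operators on $\mathscr H$ with $E_1+E_2+E_?=1$ (identity), $\operatorname{tr}(E_2\gamma_1)=0$ and $\operatorname{tr}(E_1\gamma_2)=0$. It is proper if $\operatorname{supp}(E_1+E_2)\subseteq\operatorname{supp}\mathcal S$. *)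

(* Defs.v *)
From HB Require Import structures.
From mathcomp Require Import all_boot all_order all_algebra.
From mathcomp Require Import complex reals.

Set Implicit Arguments.
Unset Strict Implicit.
Unset Printing Implicit Defensive.

Import Order.TTheory GRing.Theory Num.Theory.
Local Open Scope ring_scope.

(* A finite-dimensional Hilbert space is a vectType V over C together with a
   positive definite hermitian form dot, linear in its first argument and
   conjugate-linear in its second; completeness is automatic. *)
Section UnambiguousStateDiscrimination.
Variables (C : numClosedFieldType) (V : vectType C) (dot : {dot V for Num.conj}).
Implicit Types (A rho gamma E Einc : 'End(V)).

(* In a numClosedFieldType, 0 <= z means that z is real and nonnegative; over a
   complex space this forces A to be self-adjoint. *)
Definition psd A : Prop := forall v : V, 0 <= dot (A v) v.

Definition supp rho : {vspace V} := orthov dot (lker rho).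

(* The choice of basis is immaterial. *)
Definition lfun_trace A : C := \tr (passmx.mxof (vbasis fullv) (vbasis fullv) A).

Definition weighted_density rho : Prop := psd rho.

Definition supp_pair gamma1 gamma2 : {vspace V} := supp (gamma1 + gamma2).

Definition ker_pair gamma1 gamma2 : {vspace V} := lker (gamma1 + gamma2).

(* Einc is the operator of the inconclusive outcome, usually written E_?. *)
Definition usd_measurement gamma1 gamma2 E1 E2 Einc : Prop :=
  [/\ psd E1, psd E2 & psd Einc] /\
  [/\ E1 + E2 + Einc = \1%VF,
      lfun_trace (E2 \o gamma1)%VF = 0 &
      lfun_trace (E1 \o gamma2)%VF = 0].

Definition proper_usd_measurement gamma1 gamma2 E1 E2 Einc : Prop :=
  usd_measurement gamma1 gamma2 E1 E2 Einc /\
  (supp (E1 + E2)%R <= supp_pair gamma1 gamma2)%VS.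

End UnambiguousStateDiscrimination.

(* Main.v *)
Require Import Defs.
From HB Require Import structures.
From mathcomp Require Import all_boot all_order all_algebra.
From mathcomp Require Import complex reals.
From mathcomp Require Import ring zify.

Set Implicit Arguments.
Unset Strict Implicit.
Unset Printing Implicit Defensive.

Import Order.TTheory GRing.Theory Num.Theory.
Local Open Scope ring_scope.

(* Writing a positive [gamma] as a sum of positive rank-one operators shows that,
   for a positive [E], [tr (E gamma)] is a sum of nonnegative terms, so that it
   vanishes only if [E gamma = 0].  Hence a proper measurement satisfies
   [E2 gamma1 = 0], [E1 gamma2 = 0] and [E1 = E2 = 0] on [ker_pair]; since
   [limg gamma1 + limg gamma2 + ker_pair] is the whole space, these conditions
   and [E1 + E2 = 1 - Einc] determine [E1] and [E2]. *)

(** * The trace as a sum over a basis *)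

Section Trace.
Variables (C : numClosedFieldType) (V : vectType C).
Implicit Types A B : 'End(V).

Lemma lfun_traceE A :
  lfun_trace A = \sum_i coord (vbasis fullv) i (A (vbasis fullv)`_i).
Proof.
rewrite /lfun_trace /mxtrace; apply: eq_bigr => i _; rewrite passmx.coord_rVof.
rewrite (passmx.rVof_app _ (vbasisP fullv)) (passmx.rVofE (vbasisP fullv)).
by rewrite -rowE [RHS]mxE.
Qed.

Lemma lfun_traceD A B : lfun_trace (A + B) = lfun_trace A + lfun_trace B.
Proof.
rewrite !lfun_traceE -big_split; apply: eq_bigr => i _.
by rewrite lfunE linearD.
Qed.

Lemma lfun_trace0 : lfun_trace (0 : 'End(V)) = 0.
Proof.
by rewrite lfun_traceE big1 // => i _; rewrite lfunE linear0.
Qed.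

End Trace.

(** * Rank-one operators and their traces *)

Section RankOne.
Variables (C : numClosedFieldType) (V : vectType C).
Variable dot : {dot V for Num.conj}.
Implicit Types (u w x : V).

(** In Dirac notation this is the operator |u><w|. *)
Definition rank1 w u x : V := dot x w *: u.

Fact rank1_is_linear w u : linear (rank1 w u).
Proof.
by move=> a x y; rewrite /rank1 linearDl linearZl_LR /= scalerDl scalerA.
Qed.

HB.instance Definition _ w u :=
  GRing.isLinear.Build C V V *:%R (rank1 w u) (rank1_is_linear w u).

Lemma comp_rank1 (A : 'End(V)) w u :
  (A \o linfun (rank1 w u))%VF = linfun (rank1 w (A u)).
Proof. by apply/lfunP => x; rewrite !lfunE /= lfunE /= linearZ. Qed.

Lemma lfun_trace_rank1 w u : lfun_trace (linfun (rank1 w u)) = dot u w.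
Proof.
rewrite lfun_traceE [in RHS](coord_vbasis (memvf u)) linear_sumlz.
by apply: eq_bigr => i _; rewrite lfunE /= linearZ linearZl_LR /= mulrC.
Qed.

End RankOne.

(** * Self-adjointness, deflation and traces of positive operators *)

Section PositiveOperators.
Variables (C : numClosedFieldType) (V : vectType C).
Variable dot : {dot V for Num.conj}.
Implicit Types (A B E G : 'End(V)).

Lemma dotC u v : dot u v = (dot v u)^*.
Proof. by rewrite hermC expr0 mul1r. Qed.

Lemma psd_add A B : psd dot A -> psd dot B -> psd dot (A + B).
Proof. by move=> hA hB v; rewrite lfunE linearDl addr_ge0 ?hA ?hB. Qed.

(** Polarization: the quadratic form of [A] is real, and expanding it at [u + a *: v] gives [polar].
    Comparing [a = 1] with [a = 'i] shows that the defect of symmetry equals its own opposite. *)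
Lemma psd_adj A u v : psd dot A -> dot (A u) v = dot u (A v).
Proof.
move=> hA.
have real_form x : dot (A x) x = dot x (A x).
  by rewrite [RHS]dotC; apply/esym/CrealP/ger0_real/hA.
have polar a : a^* * (dot (A u) v - dot u (A v))
             = a * (dot v (A u) - dot (A v) u).
  have := real_form (u + a *: v).
  have -> : A (u + a *: v) = A u + a *: A v by rewrite linearD linearZ.
  rewrite !linearDl !linearDr !linearZl_LR !linearZr_LR /=.
  rewrite !mulrDr (real_form u) (real_form v) => /eqP.
  rewrite -subr_eq0 => /eqP h.
  by apply/eqP; rewrite -subr_eq0 -[X in _ == X]h; apply/eqP; ring.
have := polar 'i; have := polar 1.
rewrite conjCi rmorph1 !mul1r mulNr -mulrN => <- /(mulfI (neq0Ci _)) /eqP.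
by rewrite eqNr subr_eq0 => /eqP.
Qed.

Lemma psd_eq0 A v : psd dot A -> dot (A v) v = 0 -> A v = 0.
Proof.
move=> hA hv; apply/eqP; rewrite -(dnorm_eq0 dot); apply/negPn/negP => n0.
set n := dot _ _ in n0; set h := dot (A (A v)) (A v).
have n_real : n^* = n by apply/CrealP/ger0_real/dnorm_ge0.
have h_real : h^* = h by apply/CrealP/ger0_real/hA.
(* For real [c] the form of [A] at [A v + c *: v] equals [h + 2 c n]; this choice makes it [-1],
   against positivity. *)
pose c := - (h + 1) / (n + n).
have c_real : c^* = c.
  by rewrite rmorphM fmorphV rmorphN !rmorphD rmorph1 /= n_real h_real.
have := hA (A v + c *: v).
have -> : A (A v + c *: v) = A (A v) + c *: A v by rewrite linearD linearZ.
rewrite linearDl !linearDr !linearZl_LR !linearZr_LR /=.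
rewrite (psd_adj (A v) v hA) -/n -/h hv !mulr0 addr0 c_real -addrA -mulrDr.
rewrite divfK -?mulr2n ?mulrn_eq0 // opprD addNKr oppr_ge0.
by rewrite real_leNgt ?ltr01 ?real0 ?real1.
Qed.

(* Splitting the rank-one operator [u |-> <u, A v> A v / <A v, v>] off [A]
   leaves a positive operator with a larger kernel. *)
Lemma psd_deflate A v : psd dot A -> A v != 0 ->
  exists2 B, psd dot B /\ (\dim (lker A) < \dim (lker B))%N &
    A = B + linfun (rank1 dot (A v) ((dot (A v) v)^-1 *: A v)).
Proof.
move=> hA Av0; set a := dot (A v) v; set K := linfun _.
have a0 : a != 0 by apply: contraNneq Av0 => /(psd_eq0 hA) ->.
have KE x : K x = (dot (A x) v / a) *: A v.
  by rewrite lfunE /= /rank1 scalerA -(psd_adj x v hA).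
have BE x : (A - K) x = A x - (dot (A x) v / a) *: A v.
  by rewrite !lfunE /= opp_lfunE KE.
have Bv x : dot ((A - K) x) v = 0.
  by rewrite BE linearBl linearZl_LR /= divfK ?subrr.
exists (A - K); last by rewrite subrK.
split=> [x|].
  (* Since [(A - K) x] is orthogonal to [v], the form of [A - K] at [x] is that of [A] at
     [x - c *: v]. *)
  pose c := dot (A x) v / a.
  have BxE : (A - K) x = A (x - c *: v).
    by rewrite BE linearB /= [A (c *: v)]linearZ.
  have -> : dot ((A - K) x) x = dot (A (x - c *: v)) (x - c *: v).
    by rewrite -BxE linearBr linearZr_LR /= Bv mulr0 subr0.
  exact: hA.
have sub : (lker A <= lker (A - K))%VS.
  apply/subvP => x; rewrite !memv_ker BE => /eqP ->.
  by rewrite linear0l mul0r scale0r subrr.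
rewrite ltnNge; apply: contra Av0 => dim_le.
have /eqP kerE : lker A == lker (A - K) by rewrite eqEdim sub.
by rewrite -memv_ker kerE memv_ker BE -/a divff ?scale1r ?subrr.
Qed.

Lemma psd_trace_comp A E : psd dot A -> psd dot E ->
  0 <= lfun_trace (E \o A)%VF /\
  (lfun_trace (E \o A)%VF = 0 -> (E \o A)%VF = 0).
Proof.
move=> hA hE.
(* Induction on the rank of [A], which deflation lowers. *)
have [n] := ubnP (\dim {:V} - \dim (lker A)).
elim: n A hA => // n IHn A hA hn.
have [->|A0] := eqVneq A 0; first by rewrite comp_lfun0r lfun_trace0.
have /lfunPn[v] := A0; rewrite zero_lfunE => Av0.
have [B [hB dimB] AE] := psd_deflate hA Av0.
have dimBV := dimvS (subvf (lker B)).
have [tr_ge0 tr_eq0] : 0 <= lfun_trace (E \o B)%VF /\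
    (lfun_trace (E \o B)%VF = 0 -> (E \o B)%VF = 0).
  by apply: IHn => //; lia.
have a_gt0 : 0 < dot (A v) v.
  by rewrite lt0r hA andbT; apply: contraNneq Av0 => /(psd_eq0 hA) ->.
have trA : lfun_trace (E \o A)%VF =
    lfun_trace (E \o B)%VF + (dot (A v) v)^-1 * dot (E (A v)) (A v).
  rewrite [in LHS]AE comp_lfunDr lfun_traceD comp_rank1 lfun_trace_rank1.
  by rewrite linearZ linearZl_LR.
have tr1_ge0 : 0 <= (dot (A v) v)^-1 * dot (E (A v)) (A v).
  by rewrite mulr_ge0 ?invr_ge0 ?hE ?ltW.
rewrite trA; split=> [|/eqP]; first exact: addr_ge0.
rewrite paddr_eq0 // mulf_eq0 invr_eq0 (gt_eqF a_gt0) /=.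
move=> /andP[/eqP/tr_eq0 EB0 /eqP/(psd_eq0 hE) EAv0].
rewrite AE comp_lfunDr EB0 add0r comp_rank1 [E _]linearZ /= EAv0.
by apply/lfunP => x; rewrite !lfunE /= /rank1 !scaler0.
Qed.

End PositiveOperators.

(** * Proper measurements of a pair of positive operators *)

Section Pair.
Variables (C : numClosedFieldType) (V : vectType C).
Variable dot : {dot V for Num.conj}.
Implicit Types (A B E G : 'End(V)).

Lemma comp_lfun0_app A B x : (A \o B)%VF = 0 -> A (B x) = 0.
Proof. by move=> AB0; rewrite -comp_lfunE AB0 zero_lfunE. Qed.

Lemma psd_limg_ker A x y :
  psd dot A -> x \in limg A -> y \in lker A -> dot x y = 0.
Proof.
move=> hA /memv_imgP[z _ ->]; rewrite memv_ker => /eqP Ay.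
by rewrite psd_adj // Ay linear0r.
Qed.

Lemma psd_ker_add A B x : psd dot A -> psd dot B ->
  x \in lker (A + B) -> A x = 0 /\ B x = 0.
Proof.
move=> hA hB; rewrite memv_ker => /eqP ABx.
have : dot (A x) x + dot (B x) x == 0.
  by rewrite -linearDl -add_lfunE ABx linear0l.
rewrite paddr_eq0 ?hA ?hB //.
by move=> /andP[/eqP/(psd_eq0 hA) -> /eqP/(psd_eq0 hB)].
Qed.

(** Range and kernel are orthogonal, hence meet only in 0, and rank-nullity gives the dimension of
    their sum. *)
Lemma psd_limg_addv_lker A : psd dot A -> (limg A + lker A)%VS = fullv.
Proof.
move=> hA; apply/eqP; rewrite eqEdim subvf dimv_disjoint_sum.
  by rewrite -(limg_ker_dim A fullv) capfv addnC leqnn.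
apply/eqP; rewrite -subv0; apply/subvP => x /memv_capP[xI xK].
by rewrite memv0 -(dnorm_eq0 dot) (psd_limg_ker hA xI xK).
Qed.

Lemma psd_supp_subv A B : psd dot A ->
  (supp dot A <= supp dot B)%VS = (lker B <= lker A)%VS.
Proof.
move=> hA; apply/idP/idP => [|subBA]; last first.
  apply/subvP => x /mem_orthovP hx; apply/mem_orthovP => y yB.
  by rewrite hx // (subvP subBA).
move=> /subvP sub; apply/subvP => x xB; rewrite memv_ker -(dnorm_eq0 dot).
rewrite psd_adj //; rewrite herm_eq0C; apply/eqP.
(* The inclusion of supports makes [A (A x)] orthogonal to [x], so the squared norm of [A x]
   vanishes. *)
have /sub/mem_orthovP -> // : A (A x) \in supp dot A.
by apply/mem_orthovP => y; apply: psd_limg_ker (memv_img _ (memvf _)).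
Qed.

Variables gamma1 gamma2 : 'End(V).
Hypotheses (hgamma1 : psd dot gamma1) (hgamma2 : psd dot gamma2).

Local Notation K := (ker_pair gamma1 gamma2).

Lemma limg_ker_pair_fullv : (limg gamma1 + (limg gamma2 + K))%VS = fullv.
Proof.
apply/eqP; rewrite eqEsubv subvf /= addvA.
rewrite -[X in (X <= _)%VS](psd_limg_addv_lker (psd_add hgamma1 hgamma2)).
apply: (addvS _ (subvv _)); apply/subvP => _ /memv_imgP[z _ ->].
by rewrite lfunE memv_add // memv_img ?memvf.
Qed.

(** Trades the trace and support conditions for operator equations: a vanishing trace kills the
    product, and properness is an inclusion of kernels, which positivity splits between [E1] and
    [E2]. *)
Lemma proper_usd_measurementP E1 E2 Einc :
  proper_usd_measurement dot gamma1 gamma2 E1 E2 Einc <->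
  [/\ psd dot E1, psd dot E2 & psd dot Einc] /\
  [/\ \1%VF - Einc = E1 + E2, (E2 \o gamma1)%VF = 0, (E1 \o gamma2)%VF = 0 &
      {in K, forall x, E1 x = 0 /\ E2 x = 0}].
Proof.
split=> [[[[hE1 hE2 hEinc] [sumE tr1 tr2]] proper]|].
  split=> //; split.
  - by rewrite -sumE addrK.
  - exact: (psd_trace_comp hgamma1 hE2).2.
  - exact: (psd_trace_comp hgamma2 hE1).2.
  move=> x xK; apply: psd_ker_add => //; move: x xK; apply/subvP.
  by rewrite -psd_supp_subv //; apply: psd_add.
move=> [[hE1 hE2 hEinc] [sumE E2g1 E1g2 EK]]; split.
  by split=> //; split; rewrite ?E2g1 ?E1g2 ?lfun_trace0 // -sumE subrK.
rewrite psd_supp_subv; last exact: psd_add.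
apply/subvP => x /EK[E1x E2x].
by rewrite memv_ker add_lfunE E1x E2x addr0.
Qed.

Lemma proper_usd_measurement_unique E1 E2 E1' E2' Einc :
  proper_usd_measurement dot gamma1 gamma2 E1 E2 Einc ->
  proper_usd_measurement dot gamma1 gamma2 E1' E2' Einc ->
  E1 = E1' /\ E2 = E2'.
Proof.
move=> /proper_usd_measurementP[_ [sumE E2g1 E1g2 EK]].
move=> /proper_usd_measurementP[_ [sumE' E2g1' E1g2' EK']].
suff E1E : E1 = E1'.
  by split=> //; apply: (addrI E1); rewrite -sumE sumE' E1E.
apply/lfunP => x; move: (memvf x); rewrite -limg_ker_pair_fullv.
move=> /memv_addP[_ /memv_imgP[z1 _ ->] [y yW ->]].
move: yW => /memv_addP[_ /memv_imgP[z2 _ ->] [k kK ->]].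
rewrite !linearD /= (comp_lfun0_app _ E1g2) (comp_lfun0_app _ E1g2').
rewrite (EK k kK).1 (EK' k kK).1.
(* On [limg gamma1] both [E2] and [E2'] vanish, so [E1] and [E1'] agree there with [1 - Einc]. *)
congr (_ + _).
have := congr1 (fun F : 'End(V) => F (gamma1 z1)) (etrans (esym sumE) sumE').
by rewrite !add_lfunE (comp_lfun0_app _ E2g1) (comp_lfun0_app _ E2g1') !addr0.
Qed.

(* [1 - Einc] makes [limg gamma1] and [limg gamma2] orthogonal, so composing it
   with a projection onto [limg gamma1] along [limg gamma2 + ker_pair] yields
   [E1]; the choice made on [limg gamma1 :&: limg gamma2] does not matter, since
   [1 - Einc] vanishes there. *)
Lemma proper_usd_measurement_exists (Einc : 'End(V)) :
  {in K, forall x, Einc x = x} -> psd dot Einc -> psd dot (\1%VF - Einc) ->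
  (gamma1 \o (\1%VF - Einc) \o gamma2)%VF = 0 ->
  exists E1 E2, proper_usd_measurement dot gamma1 gamma2 E1 E2 Einc.
Proof.
set G := \1%VF - Einc => EincK hEinc hG G12.
have GK x : x \in K -> G x = 0.
  by move=> /EincK xE; rewrite add_lfunE opp_lfunE id_lfunE xE subrr.
pose W := (limg gamma2 + K)%VS.
have G_orth x y : x \in limg gamma1 -> y \in W -> dot (G x) y = 0.
  move=> /memv_imgP[z1 _ ->] /memv_addP[_ /memv_imgP[z2 _ ->] [k kK ->]].
  rewrite psd_adj // linearD /= (GK _ kK) addr0 psd_adj //.
  by rewrite -!comp_lfunE G12 zero_lfunE linear0r.
have G_cap x : x \in limg gamma1 -> x \in W -> G x = 0.
  by move=> x1 xW; apply: psd_eq0 (G_orth _ _ x1 xW).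
pose P := addv_pi1 (limg gamma1) W; pose Q := addv_pi2 (limg gamma1) W.
have P_in x : P x \in limg gamma1 by apply: memv_pi1.
have Q_in x : Q x \in W by apply: memv_pi2.
have PQ x : P x + Q x = x.
  by apply: addv_pi1_pi2; rewrite limg_ker_pair_fullv memvf.
have GP0 x : x \in W -> G (P x) = 0.
  (* As [P x = x - Q x], this vector also lies in [W]. *)
  move=> xW; apply: G_cap => //.
  by rewrite -[P x](addrK (Q x)) PQ rpredB.
have GQ0 x : x \in limg gamma1 -> G (Q x) = 0.
  move=> x1; apply: G_cap => //.
  by rewrite -[Q x](addKr (P x)) PQ addrC rpredB.
exists (G \o P)%VF, (G \o Q)%VF; apply/proper_usd_measurementP.
split; split=> //.
(* By [G_orth] the cross term vanishes, so the form of [G \o P] at [x] is that of [G] at [P x];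
   likewise for [Q]. *)
- move=> x; rewrite comp_lfunE -{2}(PQ x) linearDr /=.
  by rewrite (G_orth _ (Q x)) // addr0.
- move=> x; rewrite comp_lfunE -{2}(PQ x) linearDr /=.
  by rewrite psd_adj // dotC G_orth // rmorph0 add0r.
- by apply/lfunP => x; rewrite [RHS]add_lfunE !comp_lfunE -linearD /= PQ.
- apply/lfunP => x; rewrite !comp_lfunE zero_lfunE.
  by rewrite GQ0 // memv_img ?memvf.
- apply/lfunP => x; rewrite !comp_lfunE zero_lfunE.
  by rewrite GP0 // (subvP (addvSl _ _)) // memv_img ?memvf.
move=> x xK; have xW : x \in W by apply: (subvP (addvSr _ _)).
rewrite !comp_lfunE; split; first exact: GP0.
by have := GK _ xK; rewrite -{1}(PQ x) linearD /= (GP0 _ xW) add0r.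
Qed.

Lemma proper_usd_measurement_inconclusive E1 E2 Einc :
  proper_usd_measurement dot gamma1 gamma2 E1 E2 Einc ->
  [/\ {in K, forall x, Einc x = x}, psd dot Einc, psd dot (\1%VF - Einc) &
      (gamma1 \o (\1%VF - Einc) \o gamma2)%VF = 0].
Proof.
move=> /proper_usd_measurementP[[hE1 hE2 hEinc] [sumE E2g1 E1g2 EK]].
split=> //.
- move=> x /EK[E1x E2x]; apply/eqP; rewrite -subr_eq0 -oppr_eq0 opprB.
  have := congr1 (fun F : 'End(V) => F x) sumE.
  by rewrite !add_lfunE opp_lfunE id_lfunE E1x E2x addr0 => ->.
- by rewrite sumE; apply: psd_add.
rewrite sumE comp_lfunDr comp_lfunDl -!comp_lfunA E1g2 comp_lfun0r add0r.
apply/lfunP => x; rewrite zero_lfunE; apply/eqP.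
(* The remaining term vanishes because [gamma1 \o E2] is the adjoint of [E2 \o gamma1]. *)
rewrite -(dnorm_eq0 dot) !comp_lfunE psd_adj // psd_adj //.
by rewrite (comp_lfun0_app _ E2g1) linear0r.
Qed.

End Pair.

Theorem proposition3 (R : realType) (V : vectType R[i])
    (dot : {dot V for Num.conj}) (gamma1 gamma2 : 'End(V))
    (hgamma1 : weighted_density dot gamma1)
    (hgamma2 : weighted_density dot gamma2) (Einc : 'End(V)) :
  ((exists E1 E2 : 'End(V),
      proper_usd_measurement dot gamma1 gamma2 E1 E2 Einc) <->
   [/\ {in ker_pair gamma1 gamma2, forall v : V, Einc v = v},
       psd dot Einc,
       psd dot (\1%VF - Einc) &
       (gamma1 \o (\1%VF - Einc) \o gamma2)%VF = 0]) /\
  (forall E1 E2 E1' E2' : 'End(V),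
      proper_usd_measurement dot gamma1 gamma2 E1 E2 Einc ->
      proper_usd_measurement dot gamma1 gamma2 E1' E2' Einc ->
      E1 = E1' /\ E2 = E2').
Proof.
split=> [|E1 E2 E1' E2']; last exact: proper_usd_measurement_unique.
split=> [[E1 [E2]]|[]]; first exact: proper_usd_measurement_inconclusive.
exact: proper_usd_measurement_exists.
Qed.
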